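(* Let $\mathcal{X}=(\mathcal{V},\varrho,\upsilon)$ be a connected strong fuzzy graph and let $u$ be a vertex of $\mathcal{X}$. Then there exists a minimal strong dominating set of $\mathcal{X}$ that contains $u$.
   Context: A fuzzy graph $\mathcal{X}=(\mathcal{V},\varrho,\upsilon)$ consists of a nonempty finite set $\mathcal{V}$ of vertices, a function $\varrho:\mathcal{V}\to[0,1]$ and a symmetric function $\upsilon:\mathcal{V}\times\mathcal{V}\to[0,1]$ with $\upsilon(ab)\le\min(\varrho(a),\varrho(b))$ for all $a,b$, and no loops ($\upsilon(aa)=0$). Put $\varrho^*=\{a:\varrho(a)>0\}$ and $\upsilon^*=\{ab:\upsilon(ab)>0\}$; it is assumed that $\mathcal{V}=\varrho^*$, and the elements of $\upsilon^*$ are called edges. A path is a sequence of distinct vertices $a_1,\dots,a_n$ with $\upsilon(a_ia_{i+1})>0$ for all $i<n$; its strength is the minimum of the weights $\upsilon$ of its edges. The strength of connectedness between $a$ and $b$ is the maximum of the strengths of all paths from $a$ to $b$ (and $0$ if there is none). $\mathcal{X}$ is connected if every two vertices are joined by a path. An edge $ab$ is strong if $\upsilon(ab)$ is at least the strength of connectedness between $a$ and $b$ in the fuzzy graph obtained from $\mathcal{X}$ by deleting the edge $ab$. A fuzzy graph is a strong fuzzy graph if all its edges are strong. A set $\mathcal{D}\subseteq\mathcal{V}$ is a strong dominating set if every $b\in\mathcal{V}\setminus\mathcal{D}$ is joined by a strong edge to some $a\in\mathcal{D}$. A strong dominating set $\mathcal{D}$ is minimal if $\mathcal{D}\setminus\{a\}$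 is not a strong dominating set for every $a\in\mathcal{D}$. *)

(* Defs.v *)
From mathcomp Require Import all_boot all_order all_algebra.
From mathcomp Require Import reals.

Set Implicit Arguments.
Unset Strict Implicit.
Unset Printing Implicit Defensive.

Import Order.TTheory GRing.Theory Num.Theory.
Local Open Scope ring_scope.

(* The condition that every vertex has positive weight is not a field: it is
   the separate equation [vsupport G = [set: V]]. *)
Record fuzzyGraph (R : realType) (V : finType) := FuzzyGraph {
  vweight : V -> R;
  eweight : V -> V -> R;
  fuzzy_nonempty : (0 < #|V|)%N;
  vweight_itv : forall a, 0 <= vweight a <= 1;
  eweight_itv : forall a b, 0 <= eweight a b <= 1;
  eweight_sym : forall a b, eweight a b = eweight b a;
  eweight_le : forall a b, eweight a b <= Num.min (vweight a) (vweight b);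
  eweight_loop : forall a, eweight a a = 0
}.

Definition vsupport (R : realType) (V : finType) (G : fuzzyGraph R V) : {set V} :=
  [set a | 0 < vweight G a].

Definition is_edge (R : realType) (V : finType) (G : fuzzyGraph R V) : rel V :=
  fun a b => 0 < eweight G a b.

(* The path from [a] to [b] with vertex sequence [a :: p]. *)
Definition path_between (R : realType) (V : finType) (G : fuzzyGraph R V)
    (a b : V) (p : seq V) : bool :=
  [&& path (is_edge G) a p, uniq (a :: p) & last a p == b].

(* [pairmap] lists the weights of the consecutive edges of [a :: p]. As weights
   are at most 1, the neutral element 1 only matters for the one-vertex path,
   which joins a vertex to itself. *)
Definition path_strength (R : realType) (V : finType) (G : fuzzyGraph R V)
    (a : V) (p : seq V) : R :=
  \big[Num.min/1]_(w <- pairmap (eweight G) a p) w.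

(* The vertices [a :: p] of a path are distinct, so [size p < #|V|] and the
   bound on [n] loses no path; the maximum over no path is 0. *)
Definition conn_strength (R : realType) (V : finType) (G : fuzzyGraph R V)
    (a b : V) : R :=
  \big[Num.max/0]_(n < #|V|)
    \big[Num.max/0]_(p : n.-tuple V | path_between G a b p) path_strength G a p.

Definition fuzzy_connected (R : realType) (V : finType) (G : fuzzyGraph R V) : Prop :=
  forall a b, exists p, path_between G a b p.

Section DeleteEdge.
Variables (R : realType) (V : finType) (G : fuzzyGraph R V) (a b : V).

Definition del_weight (x y : V) : R :=
  if ((x == a) && (y == b)) || ((x == b) && (y == a)) then 0
  else eweight G x y.

Lemma del_weight_itv x y : 0 <= del_weight x y <= 1.
Proof. by rewrite /del_weight; case: ifP => _; rewrite ?lexx ?ler01 ?eweight_itv. Qed.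

Lemma del_weight_sym x y : del_weight x y = del_weight y x.
Proof.
by rewrite /del_weight eweight_sym orbC [(x == b) && _]andbC [(x == a) && _]andbC.
Qed.

Lemma del_weight_le x y : del_weight x y <= Num.min (vweight G x) (vweight G y).
Proof.
rewrite /del_weight; case: ifP => _; last exact: eweight_le.
by apply: le_trans (eweight_le G x y); case/andP: (eweight_itv G x y).
Qed.

Lemma del_weight_loop x : del_weight x x = 0.
Proof. by rewrite /del_weight eweight_loop; case: ifP. Qed.

Definition del_edge : fuzzyGraph R V :=
  FuzzyGraph (fuzzy_nonempty G) (vweight_itv G)
    del_weight_itv del_weight_sym del_weight_le del_weight_loop.

End DeleteEdge.

Definition strong_edge (R : realType) (V : finType) (G : fuzzyGraph R V) : rel V :=
  fun a b => is_edge G a b && (conn_strength (del_edge G a b) a b <= eweight G a b).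

Definition strong_fuzzy_graph (R : realType) (V : finType) (G : fuzzyGraph R V) : Prop :=
  forall a b, is_edge G a b -> strong_edge G a b.

Definition strong_dominating (R : realType) (V : finType) (G : fuzzyGraph R V)
    (D : {set V}) : bool :=
  [forall b, (b \notin D) ==> [exists a in D, strong_edge G a b]].

Definition min_strong_dominating (R : realType) (V : finType) (G : fuzzyGraph R V)
    (D : {set V}) : bool :=
  strong_dominating G D && [forall a in D, ~~ strong_dominating G (D :\ a)].

(* Main.v *)
(** A maximal independent set is a minimal dominating set, and every
    independent set, in particular [[set u]], extends to a maximal one. In a
    strong fuzzy graph "strong edge" and "edge" coincide. *)
Require Import Defs.
From mathcomp Require Import all_boot all_order all_algebra.
From mathcomp Require Import reals.

(** The case [a = b] is included, so even a singleton is independent only when [e] has no loop at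
    its vertex. *)
Definition independent (V : finType) (e : rel V) (D : {set V}) : bool :=
  [forall a in D, forall b in D, ~~ e a b].

Lemma independentP (V : finType) (e : rel V) (D : {set V}) :
  reflect {in D &, forall a b, ~~ e a b} (independent V e D).
Proof.
apply: (iffP forall_inP) => [h a b aD bD | h a aD].
  by have /forall_inP := h a aD; apply.
by apply/forall_inP => b bD; apply: h.
Qed.

(** Otherwise [b |: D] would be a strictly larger independent set: irreflexivity settles the pair
    [b], [b], and symmetry the pairs with [b] in first place. *)
Lemma maxset_independent_adjacent (V : finType) (e : rel V) (D : {set V}) (b : V) :
  symmetric e -> irreflexive e -> maxset (independent V e) D -> b \notin D ->
  exists2 a, a \in D & e a b.
Proof.
move=> e_sym e_irr /maxsetP[/independentP indD maxD] bND.
apply/exists_inP; apply: contraNT bND => /exists_inPn Nadj.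
rewrite -(maxD (b |: D)) ?setU11 ?subsetUr //.
apply/independentP => x y /setU1P[-> | xD] /setU1P[-> | yD].
- by rewrite e_irr.
- by rewrite e_sym Nadj.
- exact: Nadj.
- exact: indD.
Qed.

Lemma is_edge_sym (R : realType) (V : finType) (G : fuzzyGraph R V) :
  symmetric (is_edge G).
Proof. by move=> a b; rewrite /is_edge eweight_sym. Qed.

Lemma is_edge_irr (R : realType) (V : finType) (G : fuzzyGraph R V) :
  irreflexive (is_edge G).
Proof. by move=> a; rewrite /is_edge eweight_loop Order.POrderTheory.ltxx. Qed.

Lemma maxset_independent_min_strong_dominating (R : realType) (V : finType)
    (G : fuzzyGraph R V) (D : {set V}) :
  strong_fuzzy_graph G -> maxset (independent V (is_edge G)) D ->
  min_strong_dominating G D.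
Proof.
move=> strongG maxD; apply/andP; split.
  apply/forall_inP => b bND; apply/exists_inP.
  have [a aD eab] := maxset_independent_adjacent _ _ _ _
    (is_edge_sym R V G) (is_edge_irr R V G) maxD bND.
  (* Maximality yields only an edge; strongness of [G] makes it a strong edge. *)
  by exists a => //; apply: strongG.
have /independentP indD := maxsetp maxD.
(* The vertex left undominated by [D :\ a] is [a] itself: a strong edge to it from some [c] in
   [D :\ a] is in particular an edge inside [D], against independence. *)
apply/forall_inP => a aD; apply/negP => /forall_inP/(_ a).
rewrite setD11 => /(_ isT)/exists_inP[c /setD1P[_ cD] /andP[eca _]].
by have := indD c a cD aD; rewrite eca.
Qed.

Theorem theorem3p1 (R : realType) (V : finType) (G : fuzzyGraph R V)
  (hsupp : vsupport G = [set: V])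
  (hconn : fuzzy_connected G)
  (hstrong : strong_fuzzy_graph G)
  (u : V) :
  exists D : {set V}, min_strong_dominating G D /\ u \in D.
Proof.
have ind_u : independent V (is_edge G) [set u].
  by apply/independentP => a b /set1P-> /set1P->; rewrite is_edge_irr.
have [D maxD uD] := maxset_exists ind_u.
exists D; split; last by rewrite -sub1set.
exact: maxset_independent_min_strong_dominating.
Qed.
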